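(* Let $\mathcal{F}$ be any class of MSO sentences over a finite alphabet $A$ using letter predicates, the order $\le$ and monadic predicate symbols. Then $\mathcal{F}[\le,\mathrm{Arb}_1]\cap\mathrm{REG} = \mathcal{F}[\le,\mathcal{R}eg_1]$; more precisely, for every $\varphi(P_1,\ldots,P_\ell)\in\mathcal{F}$ and monadic predicates $\mathbf{P}_1,\ldots,\mathbf{P}_\ell$ such that $L_{\varphi,\mathbf{P}_1,\ldots,\mathbf{P}_\ell}$ is regular, there are regular monadic predicates $\mathbf{Q}_1,\ldots,\mathbf{Q}_\ell$ with $L_{\varphi,\mathbf{Q}_1,\ldots,\mathbf{Q}_\ell}=L_{\varphi,\mathbf{P}_1,\ldots,\mathbf{P}_\ell}$.
   Context: A monadic predicate is $\mathbf{P}=(\mathbf{P}_n)_n$ with $\mathbf{P}_n\subseteq\{0,\ldots,n-1\}$; $\mathrm{Arb}_1$ is the class of all of them. On a word of length $n$, $P(x)$ holds iff $x\in\mathbf{P}_n$. $L_{\varphi,\mathbf{P}_1,\ldots,\mathbf{P}_\ell}=\{u\in A^*\mid u,\mathbf{P}_1,\ldots,\mathbf{P}_\ell\models\varphi\}$, and for a class of predicates $\mathcal{P}$, $\mathcal{F}[\le,\mathcal{P}]=\{L_{\varphi,\mathbf{P}_1,\ldots,\mathbf{P}_\ell}\mid\varphi\in\mathcal{F},\ \mathbf{P}_j\in\mathcal{P}\}$. $\mathrm{REG}$ is the class of regular languages. $\mathcal{R}eg_1$ is the class of regular monadic predicates: Boolean combinations of $\{c\}$, $(\{n-1-c\})_n$,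 $\{x\mid x\equiv r\bmod q\}$ and $(\{x\mid n-1\equiv r\bmod q\})_n$ for constants $c,q,r$ (equivalently, predicates definable by an MSO formula $\psi(x)$ without predicate symbols over the one-letter alphabet, via $\mathbf{Q}_n=\{x<n\mid a^n,x\models\psi\}$). *)

(* Defs.v *)
From mathcomp Require Import all_boot.

Set Implicit Arguments.
Unset Strict Implicit.
Unset Printing Implicit Defensive.

(* MSO formulas over the alphabet A with ell monadic predicate symbols, [k]
   free first-order and [m] free set variables.  Variables are de Bruijn
   indices, the two sorts being numbered separately and 0 being the innermost
   binder. *)
Inductive mso (A : Type) (ell k m : nat) : Type :=
| MTrue
| MFalse
| MLetter of A & 'I_k
| MLe of 'I_k & 'I_k
| MEq of 'I_k & 'I_k
| MPred of 'I_ell & 'I_k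
| MIn of 'I_k & 'I_m
| MNot of mso A ell k m
| MAnd of mso A ell k m & mso A ell k m
| MOr of mso A ell k m & mso A ell k m
| MEx1 of mso A ell k.+1 m
| MAll1 of mso A ell k.+1 m
| MEx2 of mso A ell k m.+1
| MAll2 of mso A ell k m.+1.

Definition sentence (A : Type) (ell : nat) : Type := mso A ell 0 0.

Fixpoint sat (A : eqType) (ell n : nat) (u : n.-tuple A)
    (P : 'I_ell -> {set 'I_n}) (k m : nat) (phi : mso A ell k m) :
    k.-tuple 'I_n -> m.-tuple {set 'I_n} -> bool :=
  match phi with
  | MTrue => fun _ _ => true
  | MFalse => fun _ _ => false
  | MLetter a x => fun e _ => tnth u (tnth e x) == a
  | MLe x y => fun e _ => tnth e x <= tnth e y
  | MEq x y => fun e _ => tnth e x == tnth e y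
  | MPred j x => fun e _ => tnth e x \in P j
  | MIn x X => fun e E => tnth e x \in tnth E X
  | MNot f => fun e E => ~~ sat u P f e E
  | MAnd f g => fun e E => sat u P f e E && sat u P g e E
  | MOr f g => fun e E => sat u P f e E || sat u P g e E
  | MEx1 f => fun e E => [exists x : 'I_n, sat u P f [tuple of x :: e] E]
  | MAll1 f => fun e E => [forall x : 'I_n, sat u P f [tuple of x :: e] E]
  | MEx2 f => fun e E =>
      [exists X : {set 'I_n}, sat u P f e [tuple of X :: E]]
  | MAll2 f => fun e E =>
      [forall X : {set 'I_n}, sat u P f e [tuple of X :: E]]
  end.

Definition monadic : Type := forall n : nat, {set 'I_n}.

Definition language (A : Type) : Type := pred (seq A).

Definition lang (A : eqType) (ell : nat) (phi : sentence A ell)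
    (P : 'I_ell -> monadic) : language A :=
  fun u => sat (in_tuple u) (fun j => P j (size u)) phi [tuple] [tuple].

Definition regular (A : finType) (L : language A) : Prop :=
  exists (S : finType) (s0 : S) (delta : S -> A -> S) (F : {set S}),
    forall u : seq A, L u = (foldl delta s0 u \in F).

Definition Arb1 (P : monadic) : Prop := True.

Inductive Reg1 : monadic -> Prop :=
| Reg1_first (c : nat) :
    Reg1 (fun n => [set x : 'I_n | x == c :> nat])
(* x = n - 1 - c, without truncated subtraction: the set is empty if n <= c *)
| Reg1_last (c : nat) :
    Reg1 (fun n => [set x : 'I_n | x + c == n.-1])
| Reg1_mod (q r : nat) : 0 < q ->
    Reg1 (fun n => [set x : 'I_n | x == r %[mod q]])
| Reg1_length (q r : nat) : 0 < q ->
    Reg1 (fun n => [set x : 'I_n | n.-1 == r %[mod q]])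
| Reg1_compl P : Reg1 P -> Reg1 (fun n => ~: P n)
| Reg1_union P Q : Reg1 P -> Reg1 Q -> Reg1 (fun n => P n :|: Q n)
| Reg1_inter P Q : Reg1 P -> Reg1 Q -> Reg1 (fun n => P n :&: Q n)
(* predicates are identified up to pointwise equality *)
| Reg1_ext P Q : Reg1 P -> (forall n, P n = Q n) -> Reg1 Q.

Definition sentence_class (A : Type) : Type :=
  forall ell : nat, sentence A ell -> Prop.

(* [definable F C L]: L belongs to F[<=, C]. *)
Definition definable (A : eqType) (F : sentence_class A)
    (C : monadic -> Prop) (L : language A) : Prop :=
  exists (ell : nat) (phi : sentence A ell) (P : 'I_ell -> monadic),
    [/\ F ell phi, forall j, C (P j) & L =1 lang phi P].

(* Main.v *)
Require Import Defs.
From mathcomp Require Import all_boot.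
From mathcomp Require Import zify.

Set Implicit Arguments.
Unset Strict Implicit.
Unset Printing Implicit Defensive.

(** Encode [P_1, ..., P_ell] in length [n] as a word [w_n] of length [n] over the
   alphabet [B] of subsets of [{1, ..., ell}].  By Büchi's theorem [phi] is recognised
   by an automaton reading pairs [(u, w)] over [A * B], so when [L] is regular so is
   the set [K] of the words [w] such that, for every [u] of the length of [w], [phi]
   holds of [(u, w)] exactly when [u] is in [L].  Every interpretation of the
   predicates with values in [K] defines [L], and [K] contains every [w_n], hence
   words of all lengths.  Pumping one word of [K] in each residue class of
   lengths modulo [p!], [p] the pumping constant, yields words [x v^k z] in [K] of
   all large lengths, with [x], [v], [z] depending only on the residue; such words
   define regular monadic predicates. *)

(** * Closure properties of regular languages, and a few small automata *)

Lemma regular_ext (A : finType) (L L' : language A) :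
  L =1 L' -> regular L -> regular L'.
Proof.
by move=> LL' [S [s0 [d [F LE]]]]; exists S, s0, d, F => u; rewrite -LL'.
Qed.

Lemma regular_op (op : bool -> bool -> bool) (A : finType) (L1 L2 : language A) :
  regular L1 -> regular L2 -> regular (fun u => op (L1 u) (L2 u)).
Proof.
move=> [S1 [s1 [d1 [F1 L1E]]]] [S2 [s2 [d2 [F2 L2E]]]].
exists (S1 * S2)%type, (s1, s2), (fun s a => (d1 s.1 a, d2 s.2 a)).
exists [set s | op (s.1 \in F1) (s.2 \in F2)] => u.
rewrite L1E L2E inE; elim: u s1 s2 {L1E L2E} => //=.
Qed.

Lemma regularC (A : finType) (L : language A) :
  regular L -> regular (fun u => ~~ L u).
Proof. by move=> Lr; apply: (regular_op (fun b _ => ~~ b) Lr Lr). Qed.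

Lemma regular_has (A : finType) (p : pred A) : regular (has p).
Proof.
exists bool, false, (fun s a => s || p a), [set true] => u; rewrite inE eqb_id.
rewrite -[has p u]/(false || has p u); elim: u false => [|a u IHu] b /=.
  by rewrite orbF.
by rewrite orbA IHu.
Qed.

Lemma regular_cst (A : finType) (b : bool) : regular (fun _ : seq A => b).
Proof.
by have Lr := regular_has (@pred0 A); apply: (regular_op (fun _ _ => b) Lr Lr).
Qed.

Lemma regular_preim (A B : finType) (f : A -> B) (L : language B) :
  regular L -> regular (fun u => L (map f u)).
Proof.
move=> [S [s0 [d [F LE]]]]; exists S, s0, (fun s a => d s (f a)), F => u.
by rewrite LE; elim: u s0 {LE} => //= a u IHu s0.
Qed.

(** Subset construction: after reading [v] the state is the set of all states reached on preimages
    of [v], so the information erased by [f] is guessed. This projection will interpret existential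
    quantifiers. *)
Lemma regular_image (A B : finType) (f : A -> B) (L : language A) :
  regular L ->
  exists2 L' : language B, regular L' &
    forall v, L' v <-> exists2 u, map f u = v & L u.
Proof.
move=> [S [s0 [d [F LE]]]].
pose D (X : {set S}) b :=
  [set d s.1 s.2 | s in [set s : S * A | (s.1 \in X) && (f s.2 == b)]].
have DP v (X : {set S}) t :
    reflect (exists2 u, map f u = v & exists2 s, s \in X & foldl d s u = t)
            (t \in foldl D X v).
  elim: v X => [|b v IHv] X /=.
    apply: (iffP idP) => [tX|[u /eqP]]; first by exists [::] => //; exists t.
    by case: u => // _ [s sX <-].
  apply: (iffP (IHv _)) => [[u <- [s /imsetP[[s' a]]]]|[[|a u] //= [<- <-] [s sX <-]]].
    rewrite inE /= => /andP[s'X /eqP <-] -> <-.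
    by exists (a :: u) => //; exists s'.
  exists u => //; exists (d s a) => //; apply/imsetP; exists (s, a) => //.
  by rewrite inE sX eqxx.
exists (fun v => [exists t in F, t \in foldl D [set s0] v]).
  exists {set S}, [set s0], D, [set X : {set S} | [exists t in F, t \in X]] => v.
  by rewrite inE.
move=> v; split=> [/exists_inP[t tF /DP[u uv [s /set1P -> ut]]]|[u uv Lu]].
  by exists u => //; rewrite LE ut.
apply/exists_inP; exists (foldl d s0 u); first by rewrite -LE.
by apply/DP; exists u => //; exists s0 => //; apply: set11.
Qed.

(** The state records which predicate is met first. Testing [p] before [q] settles ties in favour of
    [p], and [None] accepts because both searches then return the length of the word. *)
Lemma regular_find_leq (A : finType) (p q : pred A) :
  regular (fun u => find p u <= find q u).
Proof.
pose d s a := if s is Some b then Some b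
  else if p a then Some true else if q a then Some false else None.
exists (option bool), None, d, [set~ Some false] => u; rewrite !inE.
have fix_d b v : foldl d (Some b) v = Some b by elim: v.
elim: u => //= a u IHu; case: (p a); first by rewrite fix_d.
by case: (q a); rewrite ?fix_d ?ltnS.
Qed.

(** The states [Some false], [Some true] and [None] stand for zero, one and at least two hits. *)
Lemma regular_count1 (A : finType) (p : pred A) :
  regular (fun u => count p u == 1).
Proof.
pose d s a := if p a then (if s is Some false then Some true else None) else s.
exists (option bool), (Some false), d, [set Some true] => u; rewrite inE.
have d2 v : foldl d None v = None by elim: v => //= a v; rewrite /d if_same.
have d1 v : (foldl d (Some true) v == Some true) = (count p v == 0).
  by elim: v => //= a v; rewrite [d _ a]/d; case: (p a); rewrite // d2.
elim: u => //= a u IHu; rewrite [d _ a]/d; case: (p a); rewrite ?d1 //.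
Qed.

Lemma codom_tnth (T : Type) n (u : n.-tuple T) : codom (tnth u) = u.
Proof. by rewrite codomE map_tnth_enum. Qed.

(** * From MSO to automata *)

Section MSO.

(* The predicates may depend on the word [v] over [B]: this covers both predicates
   that are read off from a component of the letters of [v] and fixed regular ones. *)
Variables (B A : finType) (ell : nat) (letter : B -> A).
Variable P : forall n, n.-tuple B -> 'I_ell -> {set 'I_n}.
Variable M : 'I_ell -> language (B * bool).
Hypothesis M_regular : forall j, regular (M j).
Hypothesis ME : forall j n (v : n.-tuple B) (x : 'I_n),
  M j (codom (fun i => (tnth v i, i == x))) = (x \in P v j).

Local Notation sym k m := (B * k.-tuple bool * m.-tuple bool)%type.

(** Büchi's encoding of a valuation by extra tracks: a first-order variable marks its position, a
    set variable contributes its characteristic function. *)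
Definition sym_at n (v : n.-tuple B) k m (e : k.-tuple 'I_n)
    (E : m.-tuple {set 'I_n}) (i : 'I_n) : sym k m :=
  (tnth v i, map_tuple (eq_op i) e, map_tuple (fun X : {set 'I_n} => i \in X) E).

Definition enc n (v : n.-tuple B) k m (e : k.-tuple 'I_n)
    (E : m.-tuple {set 'I_n}) : seq (sym k m) := codom (sym_at v e E).

(** The track of [x] carries exactly one mark, so searching for a marked letter amounts to
    inspecting the letter at that position. *)
Lemma has_enc n (v : n.-tuple B) k m (e : k.-tuple 'I_n)
    (E : m.-tuple {set 'I_n}) (x : 'I_k) (p : pred (sym k m)) :
  has (fun c => tnth c.1.2 x && p c) (enc v e E) = p (sym_at v e E (tnth e x)).
Proof.
rewrite has_map; apply/hasP/idP => [[i _]|pe] /=.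
  by rewrite tnth_map => /andP[/eqP ->].
by exists (tnth e x); rewrite ?mem_enum //= tnth_map eqxx.
Qed.

Lemma find_enc n (v : n.-tuple B) k m (e : k.-tuple 'I_n)
    (E : m.-tuple {set 'I_n}) (x : 'I_k) :
  find (fun c => tnth c.1.2 x) (enc v e E) = tnth e x.
Proof.
rewrite find_map -[RHS]index_enum_ord; apply: eq_find => i /=.
by rewrite tnth_map.
Qed.

(** The projection erases the track of the bound variable; the counting condition forces the guessed
    track to mark a single position. *)
Lemma regular_ex1 k m (L : language (sym k.+1 m)) : regular L ->
  exists2 L' : language (sym k m), regular L' &
    forall n (v : n.-tuple B) (e : k.-tuple 'I_n) (E : m.-tuple {set 'I_n}),
      L' (enc v e E) = [exists x, L (enc v [tuple of x :: e] E)].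
Proof.
move=> Lr; pose f (c : sym k.+1 m) : sym k m := (c.1.1, [tuple of behead c.1.2], c.2).
have [L' L'r L'P] := regular_image f (regular_op andb Lr
  (regular_count1 (fun c : sym k.+1 m => thead c.1.2))).
exists L' => // n v e E; apply/idP/existsP => [/L'P[u fu /andP[Lu u1]]|[x Lx]].
  have /eqP su : size u = n by rewrite -(size_map f) fu size_codom card_ord.
  pose h := tnth (Tuple su); have uE : u = codom h by rewrite codom_tnth.
  have fh i : f (h i) = sym_at v e E i.
    by move: fu; rewrite uE -map_comp => /eq_in_map; apply; rewrite mem_enum.
  have /mem_card1[x hx] : #|[pred i | thead (h i).1.2]| = 1.
    by rewrite cardE size_filter -(eqP u1) uE count_map enumT; apply: eq_count.
  exists x; suff <- : u = enc v [tuple of x :: e] E by [].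
  rewrite uE; apply: eq_map => i; have := hx i; have := fh i.
  rewrite /f /sym_at !inE; case: (h i) => [[b t] s] /= [-> te ->] tx.
  congr (_, _, _); apply: val_inj; rewrite /= -te.
  by case/tupleP: t {te} tx => y t /=; rewrite theadE => ->.
apply/L'P; exists (enc v [tuple of x :: e] E).
  rewrite -map_comp; apply: eq_map => i /=; congr (_, _, _); exact: val_inj.
rewrite Lx /= count_map (eq_count (a2 := pred1 x)) //.
by rewrite count_uniq_mem ?enum_uniq // mem_enum.
Qed.

(** Every track of bits is the characteristic function of a set, so the projection alone suffices
    here. *)
Lemma regular_ex2 k m (L : language (sym k m.+1)) : regular L ->
  exists2 L' : language (sym k m), regular L' &
    forall n (v : n.-tuple B) (e : k.-tuple 'I_n) (E : m.-tuple {set 'I_n}),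
      L' (enc v e E) = [exists X : {set 'I_n}, L (enc v e [tuple of X :: E])].
Proof.
move=> Lr; pose f (c : sym k m.+1) : sym k m := (c.1, [tuple of behead c.2]).
have [L' L'r L'P] := regular_image f Lr.
exists L' => // n v e E; apply/idP/existsP => [/L'P[u fu Lu]|[X LX]].
  have /eqP su : size u = n by rewrite -(size_map f) fu size_codom card_ord.
  pose h := tnth (Tuple su); have uE : u = codom h by rewrite codom_tnth.
  have fh i : f (h i) = sym_at v e E i.
    by move: fu; rewrite uE -map_comp => /eq_in_map; apply; rewrite mem_enum.
  pose X := [set i | thead (h i).2]; exists X.
  suff <- : u = enc v e [tuple of X :: E] by [].
  rewrite uE; apply: eq_map => i.
  have iX : (i \in X) = thead (h i).2 by rewrite inE.
  have := fh i; rewrite /f /sym_at; case: (h i) iX => [b t] /= iX [-> te].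
  congr (_, _); apply: val_inj; rewrite /= iX -te.
  by case/tupleP: t {te iX} => y t /=; rewrite theadE.
apply/L'P; exists (enc v e [tuple of X :: E]) => //.
by rewrite -map_comp; apply: eq_map => i /=; congr (_, _); apply: val_inj.
Qed.

(** Büchi's theorem by induction on [phi], universal quantifiers being negated existential ones. The
    languages are specified on encodings only, so complements may accept malformed words. *)
Lemma regular_sat k m (phi : mso A ell k m) :
  exists2 L : language (sym k m), regular L &
    forall n (v : n.-tuple B) (e : k.-tuple 'I_n) (E : m.-tuple {set 'I_n}),
      sat (map_tuple letter v) (P v) phi e E = L (enc v e E).
Proof.
elim: k m / phi => [k m|k m|k m a x|k m x y|k m x y|k m j x|k m x X
  |k m f [L Lr LE]|k m f [L Lr LE] g [L1 L1r L1E]|k m f [L Lr LE] g [L1 L1r L1E]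
  |k m f [L Lr LE]|k m f [L Lr LE]|k m f [L Lr LE]|k m f [L Lr LE]].
- by exists xpredT => //; apply: regular_cst.
- by exists xpred0 => //; apply: regular_cst.
- exists (has (fun c => tnth c.1.2 x && (letter c.1.1 == a))) => [|n v e E].
    exact: regular_has.
  by rewrite (has_enc v e E x (fun c => letter c.1.1 == a)) /= tnth_map.
- exists (fun u => find (fun c => tnth c.1.2 x) u <= find (fun c => tnth c.1.2 y) u).
    exact: regular_find_leq.
  by move=> n v e E; rewrite !find_enc.
- exists (has (fun c => tnth c.1.2 x && tnth c.1.2 y)) => [|n v e E].
    exact: regular_has.
  rewrite (has_enc v e E x (fun c => tnth c.1.2 y)) /= tnth_map //.
- exists (fun u => M j (map (fun c => (c.1.1, tnth c.1.2 x)) u)) => [|n v e E].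
    exact: regular_preim.
  rewrite /= -ME -map_comp; congr (M j _); apply: eq_map => i /=.
  by rewrite tnth_map.
- exists (has (fun c => tnth c.1.2 x && tnth c.2 X)) => [|n v e E].
    exact: regular_has.
  by rewrite (has_enc v e E x (fun c => tnth c.2 X)) /= tnth_map.
- exists (fun u => ~~ L u) => [|n v e E]; first exact: regularC.
  by rewrite /= LE.
- exists (fun u => L u && L1 u) => [|n v e E]; first exact: regular_op.
  by rewrite /= LE L1E.
- exists (fun u => L u || L1 u) => [|n v e E]; first exact: regular_op.
  by rewrite /= LE L1E.
- have [L' L'r L'E] := regular_ex1 Lr.
  by exists L' => // n v e E; rewrite L'E; apply: eq_existsb => x; apply: LE.
- have [L' L'r L'E] := regular_ex1 (regularC Lr).
  exists (fun u => ~~ L' u) => [|n v e E]; first exact: regularC.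
  by rewrite L'E negb_exists /=; apply: eq_forallb => x; rewrite LE negbK.
- have [L' L'r L'E] := regular_ex2 Lr.
  by exists L' => // n v e E; rewrite L'E; apply: eq_existsb => x; apply: LE.
- have [L' L'r L'E] := regular_ex2 (regularC Lr).
  exists (fun u => ~~ L' u) => [|n v e E]; first exact: regularC.
  by rewrite L'E negb_exists /=; apply: eq_forallb => x; rewrite LE negbK.
Qed.

End MSO.

(** * Regular monadic predicates *)

Lemma codom_eq_ord n (x : 'I_n) :
  codom (fun i => i == x) = nseq x false ++ true :: nseq (n - x.+1) false.
Proof.
have szE : size (nseq x false ++ true :: nseq (n - x.+1) false) = n.
  by rewrite size_cat /= !size_nseq addnS -addSn subnKC.
apply: (@eq_from_nth _ false); first by rewrite size_codom card_ord szE.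
move=> i; rewrite size_codom card_ord => ltin.
rewrite codomE (nth_map x) ?size_enum_ord // -val_eqE /= nth_enum_ord //.
rewrite nth_cat size_nseq nth_nseq; case: ltngtP => [//|ltxi|->]; last first.
  by rewrite subnn.
by rewrite -(subnSK ltxi) /= nth_nseq if_same.
Qed.

(** Iterating [g] on a finite type is a form of counting: one counter runs up to the mark, a second
    one starts afresh after it. *)
Lemma regular_mark (T : finType) (g : T -> T) (t0 : T) (R : T -> T -> bool) :
  exists2 M : language bool, regular M & forall n (x : 'I_n),
    M (codom (fun i => i == x)) = R (iter x g t0) (iter (n - x.+1) g t0).
Proof.
pose d (s : T * option T) (b : bool) :=
  if s.2 is Some t then (s.1, Some (g t))
  else if b then (s.1, Some t0) else (g s.1, None).
pose F := [set s : T * option T | if s.2 is Some t then R s.1 t else false].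
exists (fun u => foldl d (t0, None) u \in F); first by exists _, (t0, None), d, F.
have dN k t : foldl d (t, None) (nseq k false) = (iter k g t, None).
  by elim: k t => //= k IHk t; rewrite IHk -iterSr.
have dS k t t' : foldl d (t, Some t') (nseq k false) = (t, Some (iter k g t')).
  by elim: k t' => //= k IHk t'; rewrite IHk -iterSr.
by move=> n x; rewrite codom_eq_ord foldl_cat dN /= dS inE.
Qed.

Lemma Reg1_regular (P : monadic) : Reg1 P ->
  exists2 M : language bool, regular M & forall n (x : 'I_n),
    M (codom (fun i => i == x)) = (x \in P n).
Proof.
(* This counter saturates at [c.+1], which means more than [c]; equality with [c] can still be
   tested. *)
have iter_cap c k : iter k (fun t : 'I_c.+2 => inord (minn t.+1 c.+1)) ord0
    = minn k c.+1 :> nat.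
  elim: k => [|k IHk]; first by rewrite min0n.
  rewrite iterS inordK ?ltnS ?geq_minr // IHk.
  by rewrite -minnSS -minnA (minn_idPr (leqnSn _)).
have iter_ordS q k : iter k (@ordS q.+1) ord0 = k %% q.+1 :> nat.
  by elim: k => [|k IHk]; rewrite ?mod0n //= IHk -addn1 modnDml addn1.
have cap_eq c k : (minn k c.+1 == c) = (k == c).
  by case: (leqP k c.+1) => // lck; rewrite !gtn_eqF // ltnW.
elim=> [c|c|[//|q] r _|[//|q] r _|{}P _ [M Mr ME]|{}P Q _ [M Mr ME] _ [N Nr NE]
  |{}P Q _ [M Mr ME] _ [N Nr NE]|{}P Q _ [M Mr ME] PQ].
- have [M Mr ME] := regular_mark (fun t : 'I_c.+2 => inord (minn t.+1 c.+1))
    ord0 (fun t _ => t == c :> nat).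
  by exists M => // n x; rewrite ME iter_cap inE cap_eq.
- have [M Mr ME] := regular_mark (fun t : 'I_c.+2 => inord (minn t.+1 c.+1))
    ord0 (fun _ t => t == c :> nat).
  exists M => // n x; rewrite ME iter_cap inE cap_eq.
  case: n x => [[]//|n x] /=; rewrite subSS.
  by rewrite -(eqn_add2l x) subnKC 1?eq_sym // -ltnS.
- have [M Mr ME] := regular_mark (@ordS q.+1) ord0 (fun t _ => t == r %[mod q.+1]).
  by exists M => // n x; rewrite ME iter_ordS inE modn_mod.
(* The two counters together count all letters but the marked one, that is [n.-1] modulo [q.+1]. *)
- have [M Mr ME] := regular_mark (@ordS q.+1) ord0
    (fun t t' => t + t' == r %[mod q.+1]).
  exists M => // n x; rewrite ME !iter_ordS inE modnDm.
  by case: n x => [[]//|n x] /=; rewrite subSS subnKC // -ltnS.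
- by exists (fun u => ~~ M u) => [|n x]; rewrite ?inE ?ME //; apply: regularC.
- by exists (fun u => M u || N u) => [|n x]; rewrite ?inE ?ME ?NE //; apply: regular_op.
- by exists (fun u => M u && N u) => [|n x]; rewrite ?inE ?ME ?NE //; apply: regular_op.
- by exists M => // n x; rewrite ME PQ.
Qed.

(* [p x y] is read at the position with [x] letters before it and [y] after. *)
Definition split_monadic (p : nat -> nat -> bool) : monadic :=
  fun n => [set x : 'I_n | p x (n - x.+1)].

Local Notation regular2 p := (Reg1 (split_monadic p)).

Lemma regular2_ext (p p' : nat -> nat -> bool) :
  regular2 p -> (forall x y, p x y = p' x y) -> regular2 p'.
Proof. by move=> pr pp'; apply: Reg1_ext pr _ => n; apply/setP=> x; rewrite !inE. Qed.

Lemma regular2_and (p p' : nat -> nat -> bool) :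
  regular2 p -> regular2 p' -> regular2 (fun x y => p x y && p' x y).
Proof.
move=> pr p'r; apply: Reg1_ext (Reg1_inter pr p'r) _ => n.
by apply/setP=> x; rewrite !inE.
Qed.

Lemma regular2_or (p p' : nat -> nat -> bool) :
  regular2 p -> regular2 p' -> regular2 (fun x y => p x y || p' x y).
Proof.
move=> pr p'r; apply: Reg1_ext (Reg1_union pr p'r) _ => n.
by apply/setP=> x; rewrite !inE.
Qed.

Lemma regular2_not (p : nat -> nat -> bool) :
  regular2 p -> regular2 (fun x y => ~~ p x y).
Proof.
move=> pr; apply: Reg1_ext (Reg1_compl pr) _ => n.
by apply/setP=> x; rewrite !inE.
Qed.

Lemma regular2_left (c : nat) : regular2 (fun x _ => x == c).
Proof. by apply: Reg1_ext (Reg1_first c) _ => n; apply/setP=> x; rewrite !inE. Qed.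

Lemma regular2_cst (b : bool) : regular2 (fun _ _ => b).
Proof.
have r0 := regular2_left 0; case: b.
  by apply: regular2_ext (regular2_or r0 (regular2_not r0)) _ => x y; apply: orbN.
by apply: regular2_ext (regular2_and r0 (regular2_not r0)) _ => x y; apply: andbN.
Qed.

Lemma regular2_has (I : Type) (s : seq I) (p : I -> nat -> nat -> bool) :
  (forall i, regular2 (p i)) -> regular2 (fun x y => has (fun i => p i x y) s).
Proof.
move=> pr; elim: s => [|i s IHs]; first exact: regular2_cst.
exact: regular2_or.
Qed.

Lemma regular2_if (p p1 p2 : nat -> nat -> bool) :
  regular2 p -> regular2 p1 -> regular2 p2 ->
  regular2 (fun x y => if p x y then p1 x y else p2 x y).
Proof.
move=> pr p1r p2r; apply: regular2_ext (regular2_or (regular2_and pr p1r)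
  (regular2_and (regular2_not pr) p2r)) _ => x y.
by case: (p x y); rewrite ?orbF.
Qed.

(** As [f] takes finitely many values, this is a finite union over these values. *)
Lemma regular2_bind k (f : nat -> nat -> nat) (g : nat -> nat -> nat -> bool) :
  (forall x y, f x y < k) -> (forall c, c < k -> regular2 (fun x y => f x y == c)) ->
  (forall c, regular2 (g c)) -> regular2 (fun x y => g (f x y) x y).
Proof.
move=> fk fr gr.
have h := @regular2_has 'I_k (enum 'I_k) (fun c x y => (f x y == c) && g c x y).
apply: regular2_ext (h _) _ => [c|x y]; first exact: regular2_and (fr c _) _.
apply/hasP/idP => [[c _ /andP[/eqP ->]] //|gxy].
by exists (Ordinal (fk x y)); rewrite ?mem_enum /= ?eqxx.
Qed.

(** Saturation leaves finitely many values; the top value [T] is defined by excluding all smaller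
    ones. *)
Lemma regular2_min (f : nat -> nat -> nat) :
  (forall c, regular2 (fun x y => f x y == c)) ->
  forall (T : nat) (g : nat -> nat -> nat -> bool),
  (forall c, regular2 (g c)) -> regular2 (fun x y => g (minn (f x y) T) x y).
Proof.
move=> fr T g; apply: (@regular2_bind T.+1) => [x y|c].
  by rewrite ltnS geq_minr.
rewrite ltnS leq_eqVlt => /predU1P[->|ltcT].
  apply: regular2_ext (regular2_not (regular2_has (iota 0 T) fr)) _ => x y.
  rewrite (_ : has _ _ = (f x y < T)); last first.
    by rewrite -[RHS](mem_iota 0 T) -has_pred1; apply: eq_has => i; apply: eq_sym.
  by rewrite -leqNgt; apply/idP/eqP => [/minn_idPr|/minn_idPr].
apply: regular2_ext (fr c) _ => x y; case: leqP => // leT.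
by rewrite !gtn_eqF // (ltn_trans ltcT).
Qed.

Lemma regular2_right (c : nat) : regular2 (fun _ y => y == c).
Proof.
apply: Reg1_ext (Reg1_last c) _ => -[|n]; apply/setP=> x; first by case: x.
by rewrite !inE subSS -(eqn_add2l x (n - x)) subnKC 1?eq_sym // -ltnS.
Qed.

Lemma regular2_modl (q : nat) (g : nat -> nat -> nat -> bool) : 0 < q ->
  (forall c, regular2 (g c)) -> regular2 (fun x y => g (x %% q) x y).
Proof.
move=> q0; apply: (@regular2_bind q) => [x y|c cq]; first exact: ltn_pmod.
apply: Reg1_ext (Reg1_mod c q0) _ => n; apply/setP=> x.
by rewrite !inE (modn_small cq).
Qed.

Lemma regular2_length (q : nat) (g : nat -> nat -> nat -> bool) : 0 < q ->
  (forall c, regular2 (g c)) -> regular2 (fun x y => g ((x + y) %% q) x y).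
Proof.
move=> q0; apply: (@regular2_bind q) => [x y|c cq]; first exact: ltn_pmod.
apply: Reg1_ext (Reg1_length c q0) _ => -[|n]; apply/setP=> x; first by case: x.
by rewrite !inE (modn_small cq) subSS subnKC // -ltnS.
Qed.

(** * Pumping a word of each length *)

(** The bound on [size y] is what later makes a single number divisible by the length of every
    pumped factor. *)
Lemma pumping (A : finType) (L : language A) : regular L ->
  exists2 p, 0 < p & forall u, L u -> p <= size u ->
  exists x y z, [/\ u = x ++ y ++ z, 0 < size y <= p &
    forall k, L (x ++ flatten (nseq k y) ++ z)].
Proof.
move=> [S [s0 [d [F LE]]]]; exists #|S|; first by apply/card_gt0P; exists s0.
move=> u Lu leSu; pose f (i : 'I_#|S|.+1) := foldl d s0 (take i u).
(* Pigeonhole: two of the prefixes of lengths 0 to [#|S|] lead to the same state. *)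
have /injectivePn[i [j neqij fij]] : ~~ injectiveb f.
  by apply/injectiveP => /leq_card; rewrite card_ord ltnn.
wlog ltij : i j neqij fij / i < j.
  move=> W; case: (ltngtP i j) => [ltij|ltji|/val_inj eqij]; first exact: (W i j).
    by apply: (W j i) => //; rewrite eq_sym.
  by rewrite eqij eqxx in neqij.
have leju : j <= size u by apply: leq_trans leSu; rewrite -ltnS.
pose x := take i u; pose y := drop i (take j u); pose z := drop j u.
have xyE : x ++ y = take j u.
  by rewrite -[RHS](cat_take_drop i) take_takel // ltnW.
have uE : u = x ++ y ++ z by rewrite catA xyE cat_take_drop.
have loop : foldl d (foldl d s0 x) y = foldl d s0 x.
  by rewrite -foldl_cat xyE; apply: esym.
exists x, y, z; split=> // [|k].
  rewrite size_drop size_takel // subn_gt0 ltij /=.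
  by apply: leq_trans (leq_subr _ _) _; rewrite -ltnS.
rewrite LE !foldl_cat.
have -> : foldl d (foldl d s0 x) (flatten (nseq k y)) = foldl d s0 x.
  by elim: k => //= k IHk; rewrite foldl_cat loop.
by move: Lu; rewrite LE {1}uE !foldl_cat loop.
Qed.

Lemma size_flatten_nseq (T : Type) k (s : seq T) :
  size (flatten (nseq k s)) = k * size s.
Proof. by rewrite size_flatten /shape map_nseq sumn_nseq mulnC. Qed.

Lemma nth_flatten_nseq (T : Type) (t0 : T) k (s : seq T) i :
  i < k * size s -> nth t0 (flatten (nseq k s)) i = nth t0 s (i %% size s).
Proof.
elim: k i => [|k IHk] i; first by rewrite mul0n.
rewrite /= nth_cat mulSn => lt; case: ltnP => [lti|lei].
  by rewrite modn_small.
rewrite IHk ?ltn_subLR //; congr nth.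
by rewrite -{2}(subnK lei) modnDr.
Qed.

(** Only finitely many pairs [(x, y)] matter, so [g] may be arbitrary: saturating both arguments at
    [N] does not change the predicate. *)
Lemma regular2_small N (g : nat -> nat -> bool) :
  regular2 (fun x y => ((x + y).+1 < N) && g x y).
Proof.
pose h c d := ((c + d).+1 < N) && g c d.
have hr c : regular2 (fun _ y => h c (minn y N)).
  apply: (regular2_min regular2_right N (g := fun d _ _ => h c d)) => d.
  exact: regular2_cst.
have := regular2_min regular2_left N (g := fun c _ y => h c (minn y N)) hr.
move/regular2_ext; apply=> x y; rewrite /h; have [lt|le] := ltnP (x + y).+1 N.
  by rewrite (minn_idPl _) ?(minn_idPl _) ?lt //; lia.
by rewrite [LHS](_ : _ = false) //; apply/negbTE; rewrite negb_and; lia.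
Qed.

Lemma regular2_ltl k (g : nat -> bool) : regular2 (fun x _ => (x < k) && g x).
Proof.
apply: regular2_ext (regular2_has [seq c <- iota 0 k | g c] regular2_left) _ => x y.
rewrite -[x < k](mem_iota 0 k) andbC -mem_filter -has_pred1.
by apply: eq_has => c; apply: eq_sym.
Qed.

Lemma regular2_ltr k (g : nat -> bool) : regular2 (fun _ y => (y < k) && g y).
Proof.
apply: regular2_ext (regular2_has [seq c <- iota 0 k | g c] regular2_right) _ => x y.
rewrite -[y < k](mem_iota 0 k) andbC -mem_filter -has_pred1.
by apply: eq_has => c; apply: eq_sym.
Qed.

(** The words [w n] may vary irregularly with [n]. They are kept at finitely many lengths and
    replaced elsewhere by pumpings of one seed per residue class. *)
Lemma regular_selection (B : finType) (b0 : B) (K : language B) (w : nat -> seq B) :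
  regular K -> (forall n, size (w n) = n) -> (forall n, K (w n)) ->
  exists2 letter : nat -> nat -> B, (forall a : pred B, regular2 (fun x y => a (letter x y)))
    & forall n, K (codom (fun i : 'I_n => letter i (n - i.+1))).
Proof.
move=> Kr sw Kw; have [p p0 pump] := pumping Kr.
(* A common multiple of all possible lengths of pumped factors: repeating any of them can lengthen a
   word by exactly [q]. *)
have [q q0 dvdq] : exists2 q, 0 < q & forall d, 0 < d <= p -> d %| q.
  by exists p`!; [exact: fact_gt0 | move=> d; apply: dvdn_fact].
have lepq : p <= q * p by rewrite leq_pmull.
(* Residues are those of [n.-1], hence the [r.+1]; adding [q * p] makes the seed long enough to pump
   without changing its class. *)
have /fin_all_exists[t tP] (r : 'I_q) : exists t : seq B * seq B * seq B,
    [/\ 0 < size t.1.2, size t.1.2 %| q,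
        size t.1.1 + size t.1.2 + size t.2 = r.+1 + q * p
      & forall k, K (t.1.1 ++ flatten (nseq k t.1.2) ++ t.2)].
  have lep : p <= size (w (r.+1 + q * p)) by rewrite sw (leq_trans lepq) ?leq_addl.
  have [x [y [z [wE /andP[y0 yp] Kxyz]]]] := pump _ (Kw _) lep.
  exists (x, y, z); split=> //=; first by rewrite dvdq ?y0.
  by rewrite -[RHS]sw wE !size_cat addnA.
pose tr c := t (Ordinal (ltn_pmod c q0)).
(* From this length on, [n.-1 %/ q] is at least [p], so a seed never has to be shortened. *)
pose N := q * p.+1.
(* The last index is [x - size u] modulo [size v], written without subtraction so
   that it depends only on [x %% size v]. *)
pose per c x y := let: (u, v, z) := tr c in
  if x < size u then nth b0 u x else if y < size z then nth b0 z (size z - y.+1)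
  else nth b0 v ((x + size u * (size v).-1) %% size v).
pose letter x y := if (x + y).+1 < N then nth b0 (w (x + y).+1) x
  else per ((x + y) %% q) x y.
exists letter => [a|n].
  have per_regular c : regular2 (fun x y => a (per c x y)).
    rewrite /per; have := tP (Ordinal (ltn_pmod c q0)); rewrite -/(tr c).
    case: (tr c) => [[u v] z] [/= v0 _ _ _].
    apply: regular2_ext (regular2_or (regular2_ltl (size u) (fun x => a (nth b0 u x)))
      (regular2_and (regular2_not (regular2_ltl (size u) xpredT)) (regular2_or
        (regular2_ltr (size z) (fun y => a (nth b0 z (size z - y.+1))))
        (regular2_and (regular2_not (regular2_ltr (size z) xpredT)) (regular2_modl
          (g := fun c _ _ => a (nth b0 v ((c + size u * (size v).-1) %% size v)))
          v0 (fun _ => regular2_cst _)))))) _ => x y.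
    rewrite /= !andbT modnDml; case: ltnP => //= _; first by rewrite orbF.
    by case: ltnP => //= _; rewrite orbF.
  have := regular2_if (regular2_small N (fun _ _ => true))
    (regular2_small N (fun x y => a (nth b0 (w (x + y).+1) x)))
    (regular2_length q0 per_regular).
  by move/regular2_ext; apply=> x y; rewrite andbT /letter; case: ltnP.
have [ltnN|leNn] := ltnP n N.
  suff -> : codom (fun i : 'I_n => letter i (n - i.+1)) = w n by [].
  apply: (@eq_from_nth _ b0) => [|i]; rewrite size_codom card_ord ?sw // => ltin.
  rewrite codomE (nth_map (Ordinal ltin)) ?size_enum_ord // nth_enum_ord //.
  have iE : (i + (n - i.+1)).+1 = n by rewrite -addSn subnKC.
  by rewrite /letter iE ltnN.
have n0 : 0 < n by apply: leq_trans leNn; rewrite muln_gt0 q0.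
pose c := n.-1 %% q; pose m := n.-1 %/ q.
have lepm : p <= m by rewrite leq_divRL // mulnC; move: leNn; rewrite /N mulnS; lia.
have nE : n = (m * q + c).+1 by rewrite -divn_eq prednK.
have cE : c %% q = c by rewrite modn_mod.
have := erefl (per c); rewrite {1}/per.
have := tP (Ordinal (ltn_pmod c q0)); rewrite -/(tr c).
case: (tr c) => [[u v] z] [/= v0 /dvdnP[e qE] sE Kuvz] perE.
(* The seed contains one copy of [v] and is [(m - p) * q] letters short of [n]; as [q = e * size v],
   this amounts to [(m - p) * e] further copies. *)
pose k := ((m - p) * e).+1.
have sk : size u + k * size v + size z = n.
  have : (m - p) * q + p * q = m * q by rewrite -mulnDl subnK.
  rewrite /k mulSn -mulnA -qE [p * q]mulnC; move: sE; rewrite cE; lia.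
move: k sk => k sk.
suff -> : codom (fun i : 'I_n => letter i (n - i.+1)) = u ++ flatten (nseq k v) ++ z by [].
apply: (@eq_from_nth _ b0) => [|i]; rewrite size_codom card_ord.
  by rewrite !size_cat size_flatten_nseq addnA.
move=> ltin.
rewrite codomE (nth_map (Ordinal ltin)) ?size_enum_ord // nth_enum_ord //.
have iE : i + (n - i.+1) = n.-1 by lia.
rewrite /letter iE prednK // ltnNge leNn /= -/c -perE.
rewrite !nth_cat size_flatten_nseq; case: ltnP => // leui.
case: ltnP => ltz.
  by rewrite ltnNge (_ : k * size v <= i - size u) /=; [congr nth; lia|lia].
have ltk : i - size u < k * size v by lia.
rewrite ltk nth_flatten_nseq //; congr nth.
(* The index used in [per] exceeds [i - size u] by a multiple of the period [size v]. *)
have -> : i + size u * (size v).-1 = size u * size v + (i - size u).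
  by rewrite -{2}(prednK v0) mulnS; lia.
by rewrite modnMDl.
Qed.

(** * Languages defined with monadic predicates *)

Lemma eq_sat (A : eqType) (ell n : nat) (u : n.-tuple A)
    (P Q : 'I_ell -> {set 'I_n}) k m (phi : mso A ell k m) e E :
  (forall j, P j = Q j) -> sat u P phi e E = sat u Q phi e E.
Proof.
move=> PQ; elim: k m / phi e E => //=
  [k m j x|k m f IHf|k m f IHf g IHg|k m f IHf g IHg|k m f IHf|k m f IHf|k m f IHf|k m f IHf] e E.
- by rewrite PQ.
- by rewrite IHf.
- by rewrite IHf IHg.
- by rewrite IHf IHg.
- exact: eq_existsb.
- exact: eq_forallb.
- exact: eq_existsb.
- exact: eq_forallb.
Qed.

Definition pred_word ell (P : 'I_ell -> monadic) n : seq {ffun 'I_ell -> bool} :=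
  codom (fun i : 'I_n => [ffun j => i \in P j n]).

Lemma size_pred_word ell (P : 'I_ell -> monadic) n : size (pred_word P n) = n.
Proof. by rewrite size_codom card_ord. Qed.

(** Reading the predicates off the second components of the letters gives one automaton for all
    interpretations at once. *)
Lemma regular_lang_free (A : finType) ell (phi : sentence A ell) :
  exists2 L : language (A * {ffun 'I_ell -> bool}), regular L &
    forall (P : 'I_ell -> monadic) u, lang phi P u = L (zip u (pred_word P (size u))).
Proof.
pose B := (A * {ffun 'I_ell -> bool})%type.
pose P0 n (v : n.-tuple B) j := [set i | (tnth v i).2 j].
have [j|j n v x|L Lr LE] := @regular_sat B A ell fst P0
  (fun j => has (fun c : B * bool => c.2 && c.1.2 j)) _ _ 0 0 phi.
- exact: regular_has.
- rewrite has_map inE; apply/hasP/idP => [[i _] /= /andP[/eqP ->]|vx] //.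
  by exists x; rewrite ?mem_enum //= eqxx.
exists (fun v => L (map (fun c => (c, [tuple], [tuple])) v)) => [|P u].
  exact: (regular_preim (fun c : B => (c, [tuple], [tuple]))).
pose v : (size u).-tuple B :=
  [tuple (tnth (in_tuple u) i, [ffun j => i \in P j (size u)]) | i < size u].
have -> : zip u (pred_word P (size u)) = v.
  rewrite -[X in zip X _](codom_tnth (in_tuple u)) /pred_word !codomE.
  by rewrite zip_map.
have uE : in_tuple u = map_tuple fst v.
  by apply: eq_from_tnth => i; rewrite tnth_map tnth_mktuple.
rewrite /lang (eq_sat _ _ _ _ (Q := P0 _ v)) => [|j]; last first.
  by apply/setP=> i; rewrite inE tnth_mktuple ffunE.
rewrite uE LE; congr L.
rewrite -(codom_tnth v) !codomE -map_comp; apply: eq_map => i /=.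
by congr (_, _, _); apply: val_inj.
Qed.

(** This gives the inclusion from right to left: an atom for [Q j] is tested by an automaton that
    looks only at the mark of its variable. *)
Lemma regular_lang_Reg1 (A : finType) ell (phi : sentence A ell) (Q : 'I_ell -> monadic) :
  (forall j, Reg1 (Q j)) -> regular (lang phi Q).
Proof.
move=> /(fun h j => Reg1_regular (h j))/fin_all_exists2[M Mr ME].
have [j|j n v x|L Lr LE] := @regular_sat A A ell id (fun n _ j => Q j n)
  (fun j u => M j (map snd u)) _ _ 0 0 phi.
- exact: regular_preim.
- by rewrite -ME -map_comp.
apply: regular_ext (regular_preim (fun a : A => (a, [tuple], [tuple])) Lr) => u.
have uE : in_tuple u = map_tuple id (in_tuple u) by apply: val_inj; rewrite /= map_id.
rewrite /lang uE LE; congr L.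
rewrite -{1}[u](codom_tnth (in_tuple u)) !codomE -map_comp; apply: eq_map => i /=.
by congr (_, _, _); apply: val_inj.
Qed.

Lemma regular_lang_Reg1_exists (A : finType) ell (phi : sentence A ell)
    (P : 'I_ell -> monadic) :
  regular (lang phi P) ->
  exists Q : 'I_ell -> monadic, (forall j, Reg1 (Q j)) /\ lang phi Q =1 lang phi P.
Proof.
move=> Lr; have [L' L'r L'E] := regular_lang_free phi.
(* This [K] collects the bad words, those for which [phi] disagrees with the given language on some
   [u]. The set to be pumped is its complement. *)
have [K Kr KP] := regular_image snd
  (regular_op (fun b c => b != c) L'r (regular_preim fst Lr)).
have PK n : ~~ K (pred_word P n).
  apply/negP => /KP[v vP].
  have nE : size (map fst v) = n by rewrite -(size_pred_word P n) -vP !size_map.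
  have vE : v = zip (map fst v) (pred_word P n) by rewrite -vP -[LHS]zip_unzip.
  by rewrite {1}vE -{1}nE -L'E eqxx.
have [letter letter_regular letterK] := @regular_selection _ [ffun=> false] _ (pred_word P)
  (regularC Kr) (size_pred_word P) PK.
pose Q j := split_monadic (fun x y => letter x y j).
exists Q; split=> [j|u]; first exact: (letter_regular (fun b => b j)).
have QE n : pred_word Q n = codom (fun i : 'I_n => letter i (n - i.+1)).
  by apply: eq_map => i; apply/ffunP => j; rewrite ffunE inE.
have := letterK (size u); rewrite -QE => /negP nK.
(* A word [u] on which the two languages differ would make [pred_word Q (size u)] bad. *)
apply/eqP/negPn/negP => neq; apply: nK; apply/KP.
exists (zip u (pred_word Q (size u))).
  by rewrite -[map snd _]/(unzip2 _) unzip2_zip ?size_pred_word.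
by rewrite -L'E -[map fst _]/(unzip1 _) unzip1_zip ?size_pred_word.
Qed.

Theorem mainTheorem10 (A : finType) (F : sentence_class A) :
  (forall L : language A,
     (definable F Arb1 L /\ regular L) <-> definable F Reg1 L)
  /\ (forall (ell : nat) (phi : sentence A ell) (P : 'I_ell -> monadic),
        F ell phi -> regular (lang phi P) ->
        exists Q : 'I_ell -> monadic,
          (forall j, Reg1 (Q j)) /\ lang phi Q =1 lang phi P).
Proof.
split=> [L|ell phi P _]; last exact: regular_lang_Reg1_exists.
split=> [[[ell [phi [P [Fphi _ LE]]]] Lr]|[ell [phi [Q [Fphi Qr LE]]]]].
  have [Q [Qr QE]] := regular_lang_Reg1_exists (regular_ext LE Lr).
  by exists ell, phi, Q; split=> // u; rewrite LE QE.
split; first by exists ell, phi, Q; split.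
apply: regular_ext (regular_lang_Reg1 phi Qr) => u; exact/esym.
Qed.
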